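(* Let $S^n_{\ell;d;(n_1,\ldots,n_\ell)}$ be the coefficients defined in the context. For every $n$ and every list $\ell;d;(n_1,\ldots,n_\ell)$ admissible for $n$ with $\ell\ge1$, $$S^n_{\ell;d;(n_1,\ldots,n_\ell)}=\sum_{(\sigma_1,\ldots,\sigma_\ell)\in\mathfrak{S}(n_1,\ldots,n_\ell)}\ \sum_{d_1=0}^d\ \sum_{d_2=0}^{d_1+\sigma_1+1}\cdots\sum_{d_\ell=0}^{d_{\ell-1}+\sigma_{\ell-1}+1}\ \prod_{i=1}^\ell\binom{d_i+\sigma_i}{\sigma_i}\Bigl(1+(-1)^{\sigma_i+\ldots+\sigma_\ell}\,\delta(d_i)\bigl(1-\delta(d)\delta(i-1)\bigr)\Bigr),$$ where $(\sigma_1,\ldots,\sigma_\ell)\in\mathfrak{S}(n_1,\ldots,n_\ell)$ means that the sum is taken over all distinct permutations of the numbers $n_1,\ldots,n_\ell$, and $\delta(t)=1$ if $t=0$ and $\delta(t)=0$ otherwise.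
   Context: A list $\ell;d;(n_1,\ldots,n_\ell)$ of non-negative integers is admissible for $n$ if $0\le\ell\le\frac n2$, $0\le d\le n-2\ell$, $0\le n_1\le n_2\le\ldots\le n_\ell$ and $n_1+\ldots+n_\ell+2\ell+d=n$. The coefficients $S^n_{\ell;d;(n_1,\ldots,n_\ell)}$ arise from rewriting $(\partial_u-\partial_v)^n\mathbf{H}$ for a (formal, smooth) solution $\mathbf{H}(u,v)$ of $\partial_u\partial_v\mathbf{H}=q(u+v)\mathbf{H}$, as follows. Let $E^n_d$ stand for the expression $\bigl(\partial_u^d+(-1)^n\partial_v^d\bigr)\mathbf{H}(u,v)$, with $\partial_u^0=\partial_v^0$ the identity; $E^n_d$ is treated as a formal symbol (also when $d=0$ and $n$ is odd, where its value is $0$). Start with $\mathbf{H}=\frac12E^0_0$. Given the representation of $(\partial_u-\partial_v)^n\mathbf{H}$ as a linear combination of terms $E^n_d\prod_{i=1}^\ell q^{(n_i)}(u+v)$, apply $\partial_u-\partial_v$ to each term, using the Leibniz rule, $(\partial_u-\partial_v)q^{(k)}(u+v)=0$ and $\partial_u\partial_v\mathbf{H}=q(u+v)\mathbf{H}$; that is, $$E^n_0\prod_{i=1}^\ell q^{(n_i)}\longmapsto\bigl(1+(-1)^n\bigr)E^{n+1}_1\prod_{i=1}^\ell q^{(n_i)},$$ $$E^n_d\prod_{i=1}^\ell q^{(n_i)}\longmapsto E^{n+1}_{d+1}\prod_{i=1}^\ell q^{(n_i)}-\sum_{k=0}^{d-1}\binom{d-1}kq^{(k)}E^{n+1}_{d-1-k}\prod_{i=1}^\ell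 q^{(n_i)}\qquad(d\ge1),$$ where $q^{(k)}$ means $q^{(k)}(u+v)$. In the resulting representation of $(\partial_u-\partial_v)^n\mathbf{H}$, after collecting like terms (factors $q^{(n_i)}$ commute and are listed with $n_1\le\ldots\le n_\ell$), the coefficient of $E^n_d\prod_{i=1}^\ell q^{(n_i)}(u+v)$ is denoted $(-1)^\ell S^n_{\ell;d;(n_1,\ldots,n_\ell)}$. By convention $S^n_{\ell;d;(n_1,\ldots,n_\ell)}=0$ whenever the list is not admissible for $n$. *)

(* Defs.v *)
From mathcomp Require Import all_boot all_order all_algebra.

Set Implicit Arguments.
Unset Strict Implicit.
Unset Printing Implicit Defensive.

Import Order.TTheory GRing.Theory Num.Theory.
Local Open Scope ring_scope.

(* [2 * l <= n] is [l <= n / 2] over the rationals. *)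
Definition admissible (n l d : nat) (ns : seq nat) : bool :=
  [&& size ns == l, (2 * l <= n)%N, (d <= n - 2 * l)%N, sorted leq ns
    & (sumn ns + 2 * l + d == n)%N].

(* [(c, (d, ns))] stands for the term c * E^n_d * \prod_(k <- ns) q^(k)(u+v).
   The superscript n is not stored: all the terms of a representation of
   (d_u - d_v)^n H share it. The factors of [ns] are in no particular order. *)
Definition term : Type := (rat * (nat * seq nat))%type.

(* The image under d_u - d_v of a term with superscript [n], as a list of terms
   with superscript [n.+1]. *)
Definition step (n : nat) (t : term) : seq term :=
  let: (c, (d, ns)) := t in
  if d is d'.+1 then
    (c, (d.+1, ns)) ::
      [seq (- (c * 'C(d', k)%:R), ((d' - k)%N, k :: ns)) | k <- iota 0 d]
  else [:: (c * (1 + (-1) ^+ n), (1%N, ns))].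

(* The representation of (d_u - d_v)^n H before like terms are collected. *)
Fixpoint expansion (n : nat) : seq term :=
  if n is m.+1 then flatten [seq step m t | t <- expansion m]
  else [:: (1 / 2, (0%N, [::]))].

(* The coefficient after like terms are collected; the q^(k) commute. *)
Definition coefficient (n d : nat) (ns : seq nat) : rat :=
  \sum_(t <- expansion n | (t.2.1 == d) && perm_eq t.2.2 ns) t.1.

(* [coefficient] is (-1)^l S, and (-1)^l is its own inverse. *)
Definition S_coef (n l d : nat) (ns : seq nat) : rat :=
  if admissible n l d ns then (-1) ^+ l * coefficient n d ns else 0.

Definition delta (t : nat) : rat := (t == 0%N)%:R.

(* All [:: d_1; ...; d_l] with 0 <= d_1 <= b and
   0 <= d_i <= d_(i-1) + s_(i-1) + 1 for 2 <= i <= l, where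
   s = [:: s_1; ...; s_l]: the index set of the iterated sum. *)
Fixpoint ranges (b : nat) (s : seq nat) : seq (seq nat) :=
  if s is x :: s' then
    [seq e :: r | e <- iota 0 b.+1, r <- ranges (e + x + 1)%N s']
  else [:: [::]].

(* Main.v *)
Require Import Defs.
From mathcomp Require Import all_boot all_order all_algebra.
From mathcomp Require Import ring zify.

Set Implicit Arguments.
Unset Strict Implicit.
Unset Printing Implicit Defensive.

Import Order.TTheory GRing.Theory Num.Theory.
Local Open Scope ring_scope.

(** The expansion never reorders the factors of a term: every new factor is
    put in front. So the list of a term records the order in which its factors
    were created, the most recent first, and the coefficient attached to a
    multiset of factors is the sum, over its distinct arrangements s, of the
    coefficient attached to the exact list s ([coefficient_ordered]). Each
    arrangement contributes one of the iterated sums.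

    For a fixed list k :: s, read the history of a term backwards. The factor
    q^(k) was split off from some E_(e + k + 1), with coefficient
    -C(e + k, k), leaving E_e; then e was raised one unit at a time to its
    final value d. Each raise has weight 1, except that a raise of
    E^m_0 has weight 1 + (-1)^m. This proves that the ordered coefficient is,
    up to the sign (-1)^l, the recursive sum [nested_sum], by induction on n
    ([ordered_coef_nested]): adding a derivative either raises E_d or creates
    the front factor, and this is the step from d to d + 1 of the outermost
    sum ([nested_sumS]).

    The exponents m disappear because all terms satisfy
    n = n_1 + ... + n_l + 2 l + d, so that when d = 0 the parity of n is the
    parity of the sum of the n_i. The weight 1 + (-1)^m occurs exactly when
    the index e is 0 and E_0 is raised afterwards. When e is the index
    left by the creation of an older factor, this raise always takes place, since the next factor has to be split off from some E_b with
    b > 0; after the creation of the most recent factor, it is missing exactly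
    when the final d is 0, which explains the correction
    1 - delta(d) delta(i - 1). Unfolding [nested_sum] then gives the formula
    ([nested_sum_ranges]). *)

Definition ordered_coef (n d : nat) (s : seq nat) : rat :=
  \sum_(t <- expansion n | t.2 == (d, s)) t.1.

Definition raise_factor (n d : nat) : rat := 1 + (-1) ^+ n * delta d.

Lemma raise_factor0 n : raise_factor n 0 = 1 + (-1) ^+ n.
Proof. by rewrite /raise_factor mulr1. Qed.

Lemma raise_factorS n d : raise_factor n d.+1 = 1.
Proof. by rewrite /raise_factor mulr0 addr0. Qed.

(** [permutations ns] lists every arrangement of [ns] once, so each term of the
    expansion with the right multiset of factors is counted for one [s]. *)
Lemma coefficient_ordered n d ns :
  coefficient n d ns = \sum_(s <- permutations ns) ordered_coef n d s.
Proof.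
rewrite /coefficient /ordered_coef.
under [RHS]eq_bigr do rewrite big_mkcond.
rewrite exchange_big [LHS]big_mkcond; apply: eq_bigr => -[c [e r]] _ /=.
rewrite -big_mkcond -mem_permutations.
under [RHS]eq_bigl do rewrite xpair_eqE.
case: (e == d) => /=; last by rewrite big_pred0.
under [RHS]eq_bigl do rewrite eq_sym.
have [r_in|r_out] := boolP (r \in permutations ns).
  by rewrite -big_filter filter_pred1_uniq ?permutations_uniq // big_seq1.
rewrite big1_seq // => s /andP[/eqP-> r_in].
by rewrite r_in in r_out.
Qed.

(** A term can reach [(d, s)] in two ways: by raising its index to [d], or by
    splitting off the first factor of [s]. *)
Lemma step_coef n (t : term) d s :
  \sum_(u <- step n t | u.2 == (d, s)) u.1 =
    (if d is d'.+1 then if t.2 == (d', s) then t.1 * raise_factor n d' else 0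
     else 0) -
    (if s is k :: s' then
       if t.2 == ((d + k).+1, s') then t.1 * 'C(d + k, k)%:R else 0
     else 0).
Proof.
case: t => c [e r] /=.
(* The index k of a newly created term is determined by its list. *)
have lower_eq (e' : nat) : \sum_(k <- iota 0 e'.+1 | ((e' - k)%N, k :: r) == (d, s))
      - (c * 'C(e', k)%:R) =
    - (if s is k :: s' then
       if (e'.+1, r) == ((d + k).+1, s') then c * 'C(d + k, k)%:R else 0
     else 0).
  case: s => [|j s]; first by rewrite big1 ?oppr0 // => k /eqP.
  rewrite -[iota _ _]/(index_iota 0 e'.+1) big_mkord xpair_eqE eqSS.
  have [e'E|e'N] /= := eqVneq e' (d + j)%N; last first.
    rewrite big1 ?oppr0 // => k; rewrite xpair_eqE eqseq_cons => /and3P[/eqP kE /eqP jE _].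
    by move: e'N (ltn_ord k); rewrite -kE -jE; lia.
  have [->|rN] := eqVneq r s; last first.
    rewrite big1 ?oppr0 // => k; rewrite xpair_eqE eqseq_cons => /and3P[_ _ rE].
    by rewrite rE in rN.
  have j_lt : (j < e'.+1)%N by lia.
  rewrite (big_pred1 (Ordinal j_lt)) /= ?e'E // => k.
  rewrite xpair_eqE eqseq_cons eqxx andbT /= -val_eqE /=.
  by have := ltn_ord k; lia.
case: e => [|e]; rewrite /step big_cons ?big_map ?big_nil /=
  -?[0%N :: iota 1 e]/(iota 0 e.+1).
  rewrite xpair_eqE (_ : (if s is k :: _ then _ else _) = 0) ?subr0; last first.
    by case: s {lower_eq}.
  case: d {lower_eq} => [|d] //; rewrite eqSS xpair_eqE.
  case: ifP => [/andP[/eqP<- _]|] //.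
  by rewrite raise_factor0.
rewrite lower_eq.
case: d {lower_eq} => [|d]; rewrite ?add0r //.
rewrite !xpair_eqE !eqSS.
case: ifP => [/andP[/eqP<- _]|_]; last by rewrite add0r.
by rewrite raise_factorS mulr1.
Qed.

Lemma ordered_coefS n d s :
  ordered_coef n.+1 d s =
    (if d is d'.+1 then ordered_coef n d' s * raise_factor n d' else 0) -
    (if s is k :: s' then ordered_coef n (d + k).+1 s' * 'C(d + k, k)%:R else 0).
Proof.
rewrite /ordered_coef big_flatten big_map.
under eq_bigr do rewrite step_coef.
rewrite sumrB; congr (_ - _); [case: d => [|d]|case: s => [|k s]];
  by [rewrite big1 | rewrite mulr_suml [RHS]big_mkcond].
Qed.

(** The value 1/2 is the coefficient in H = 1/2 E^0_0. The first raise turns it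
    into 1 = 1/2 (1 + 1), which is the coefficient of E^d_d for d > 0. *)
Fixpoint nested_sum (d : nat) (s : seq nat) : rat :=
  if s is k :: s' then
    \sum_(0 <= e < d.+1) 'C(e + k, k)%:R
      * (1 + (-1) ^+ sumn s * delta e * (1 - delta d))
      * nested_sum (e + k).+1 s'
  else if d is 0 then 1 / 2 else 1.

Lemma nested_sum_cons d k s :
  nested_sum d (k :: s) =
    \sum_(0 <= e < d.+1) 'C(e + k, k)%:R
      * (1 + (-1) ^+ sumn (k :: s) * delta e * (1 - delta d))
      * nested_sum (e + k).+1 s.
Proof. by []. Qed.

(** Passing from [d] to [d.+1] adds the summand of index [d.+1] and switches the
    correction [1 - delta d] on: the summands for [d = 0] acquire the weight of
    the raise from E_0, and those for [d > 0] do not change. *)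
Lemma nested_sumS d k s :
  nested_sum d.+1 (k :: s) =
    nested_sum d (k :: s) * raise_factor (sumn (k :: s)) d
    + 'C(d.+1 + k, k)%:R * nested_sum (d.+1 + k).+1 s.
Proof.
rewrite !nested_sum_cons big_nat_recr // [delta d.+1]/(0 : rat) !(mulr0, mul0r).
rewrite addr0 mulr1; congr (_ + _); case: d => [|d].
  by rewrite !big_nat1 raise_factor0 /delta /=; ring.
by rewrite raise_factorS mulr1.
Qed.

(** The value of n is the only one for which the coefficient can be nonzero; it
    fixes the parity that enters [raise_factor]. *)
Lemma ordered_coef_nested d s :
  ordered_coef (sumn s + 2 * size s + d) d s = (-1) ^+ size s * nested_sum d s.
Proof.
move En : (sumn s + 2 * size s + d)%N => n.
elim: n d s En => [|n IHn] d s En.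
  have -> : d = 0%N by lia.
  have -> : s = [::] by case: s En => //= *; lia.
  by rewrite /ordered_coef big_cons big_nil eqxx addr0 mul1r.
rewrite ordered_coefS; case: s En => [|k s] En.
  rewrite subr0; case: d En => [|d] En; first by rewrite addn0 in En.
  have {}En : (sumn [::] + 2 * size (Nil nat) + d = n)%N by move: En => /=; lia.
  rewrite IHn // -En; case: d {En} => [|d] /=; first by rewrite raise_factor0.
  by rewrite raise_factorS.
rewrite IHn; last by move: En => /=; lia.
case: d En => [|d] En.
  rewrite nested_sum_cons big_nat1 /delta binn /= exprS; ring.
rewrite IHn; last by move: En => /=; lia.
(* For d = 0, n and the sum of the factors differ by 2 (size s).+1. *)
have -> : raise_factor n d = raise_factor (sumn (k :: s)) d.
  rewrite /raise_factor /delta; case: d En => [|d] En; last by rewrite !mulr0.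
  have -> : n = (sumn (k :: s) + 2 * (size s).+1)%N by move: En => /=; lia.
  by rewrite exprD exprM sqrrN !expr1n !mulr1.
rewrite nested_sumS /= exprS; ring.
Qed.

(** After the first factor the bound of the next sum is positive, so its
    [delta] vanishes, as does [delta i] for i > 0 in the product: the
    correction only affects the outermost index. The hypothesis excludes the
    empty list with [d = 0], where [nested_sum] is 1/2 and the product is 1. *)
Lemma nested_sum_ranges d s : (0 < d + size s)%N ->
  nested_sum d s =
  \sum_(ds <- ranges d s)
    \prod_(i < size s)
      ('C(nth 0%N ds i + nth 0%N s i, nth 0%N s i)%:R *
       (1 + (-1) ^+ (\sum_(i <= j < size s) nth 0%N s j)%N
            * delta (nth 0%N ds i) * (1 - delta d * delta i))).
Proof.
elim: s d => [|k s IHs] d.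
  by case: d => // d _; rewrite /= big_seq1 big_ord0.
move=> _; rewrite nested_sum_cons sumnE (big_nth 0%N) big_allpairs_dep.
rewrite -[iota _ _]/(index_iota 0 d.+1).
apply: eq_bigr => e _; rewrite IHs ?addn1 // mulr_sumr.
apply: eq_bigr => ds _; rewrite big_ord_recl.
congr (_ * _); last first.
  by apply: eq_bigr => i _; rewrite /= big_add1 /= /delta /= mul0r mulr0.
by congr (_ * (1 + _ * (1 - _))); rewrite [RHS]mulr1.
Qed.

Theorem proposition8p4 (n l d : nat) (ns : seq nat)
    (ns_adm : admissible n l d ns) (l_ge1 : (1 <= l)%N) :
  S_coef n l d ns =
  \sum_(s <- permutations ns)
    \sum_(ds <- ranges d s)
      \prod_(i < l)
        ('C(nth 0%N ds i + nth 0%N s i, nth 0%N s i)%:R *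
         (1 + (-1) ^+ (\sum_(i <= j < l) nth 0%N s j)%N
              * delta (nth 0%N ds i) * (1 - delta d * delta i))).
Proof.
rewrite /S_coef ns_adm coefficient_ordered mulr_sumr.
have /and5P[/eqP sz_ns _ _ _ /eqP n_eq] := ns_adm.
apply: eq_big_seq => s; rewrite mem_permutations => s_ns.
have sz_s : size s = l by rewrite (perm_size s_ns).
have <- : (sumn s + 2 * size s + d)%N = n by rewrite (perm_sumn s_ns) sz_s.
rewrite ordered_coef_nested sz_s mulrA -exprD -signr_odd oddD addbb mul1r.
by rewrite -sz_s nested_sum_ranges // sz_s; lia.
Qed.
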